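(* Let $\langle X,\mathcal{U},k\rangle$ be an infinite computable $T_1$ CSC space. Then $X$ has an infinite $\Delta^0_2$ discrete subspace, or an infinite computable subspace with the cofinite topology.
   Context: A CSC space is a tuple $\langle X,\mathcal{U},k\rangle$ where $X\subseteq\omega$; $\mathcal{U}=\langle U_n:n\in\omega\rangle$ is a sequence of subsets of $X$ covering $X$; and $k:X\times\omega\times\omega\to\omega$ is such that whenever $x\in U_m\cap U_n$, $x\in U_{k(x,m,n)}\subseteq U_m\cap U_n$. Write $U\in\mathcal{U}$ if $U=U_n$ for some $n$. It is computable if $X$ is computable, $\mathcal{U}$ uniformly computable and $k$ computable; infinite if $X$ is infinite; $T_1$ if for all $x\ne y$ in $X$ there are $U,V\in\mathcal{U}$ with $x\in U\setminus V$, $y\in V\setminus U$. A subspace $Y\subseteq X$ has basis $\langle U_n\cap Y\rangle$; it is discrete if $\{x\}$ is a basic open set of $Y$ for every $x\in Y$, and has the cofinite topology if $Y$ is infinite and the basic open sets of $Y$ are exactly $\emptyset$ and the cofinite subsets of $Y$. ''$\Delta^0_2$ subspace'' / ''computable subspace'' refers to the complexity of the set $Y$.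
   Formalization: ''Cofinite topology'' on Y is taken to mean that the open sets (unions of basic open sets) of Y, rather than the basic open sets themselves, are exactly the empty set and the cofinite subsets; read with basic open sets the claim fails, e.g. for the basis {x} ∪ [n,∞) on ω. *)

(* Defs.v *)
From HB Require Import structures.
From mathcomp Require Import all_boot.
From mathcomp Require Import boolp classical_sets functions cardinality.

Set Implicit Arguments.
Unset Strict Implicit.
Unset Printing Implicit Defensive.

Local Open Scope classical_set_scope.

(* The total recursive functions of n arguments: minimization is applied only
   to regular functions (those having a zero for every value of the
   parameters), so every function obtained is total and, by the normal form
   theorem, all total computable functions are obtained.  The closure rules are
   stated by the equations that determine h, which makes the class closed under
   extensional equality. *)
Inductive recursive : forall n : nat, (n.-tuple nat -> nat) -> Prop :=
| rec_zero n : recursive (fun _ : n.-tuple nat => 0)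
| rec_succ : recursive (fun v : 1.-tuple nat => (tnth v ord0).+1)
| rec_proj n (i : 'I_n) : recursive (fun v : n.-tuple nat => tnth v i)
| rec_comp n m (f : m.-tuple nat -> nat) (g : 'I_m -> n.-tuple nat -> nat)
    (h : n.-tuple nat -> nat) :
    recursive f -> (forall i, recursive (g i)) ->
    (forall v, h v = f [tuple g i v | i < m]) ->
    recursive h
| rec_prec n (f : n.-tuple nat -> nat) (g : n.+2.-tuple nat -> nat)
    (h : n.+1.-tuple nat -> nat) :
    recursive f -> recursive g ->
    (forall v : n.-tuple nat, h [tuple of 0 :: v] = f v) ->
    (forall j (v : n.-tuple nat),
       h [tuple of j.+1 :: v] = g [tuple of j :: h [tuple of j :: v] :: v]) ->
    recursive h
| rec_min n (f : n.+1.-tuple nat -> nat) (h : n.-tuple nat -> nat) :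
    recursive f ->
    (forall v : n.-tuple nat, f [tuple of h v :: v] = 0) ->
    (forall (v : n.-tuple nat) y, y < h v -> f [tuple of y :: v] <> 0) ->
    recursive h.

Definition computable_rel n (P : set (n.-tuple nat)) : Prop :=
  exists chi : n.-tuple nat -> bool,
    recursive (fun v => nat_of_bool (chi v)) /\ forall v, P v <-> chi v.

Definition computable_set (A : set nat) : Prop :=
  computable_rel [set v : 1.-tuple nat | A (tnth v ord0)].

Definition uniformly_computable (U : nat -> set nat) : Prop :=
  computable_rel [set v : 2.-tuple nat | U (nth 0 v 0) (nth 0 v 1)].

Definition Sigma02 (A : set nat) : Prop :=
  exists R : set (3.-tuple nat), computable_rel R /\
    forall x, A x <-> exists a, forall b, R [tuple x; a; b].

Definition Pi02 (A : set nat) : Prop :=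
  exists R : set (3.-tuple nat), computable_rel R /\
    forall x, A x <-> forall a, exists b, R [tuple x; a; b].

Definition Delta02 (A : set nat) : Prop := Sigma02 A /\ Pi02 A.

(* The function k is only meaningful on points of the space; its values at
   other first arguments are unconstrained, also in [computable_csc]. *)
Record csc_space := CSCSpace {
  csc_points : set nat;
  csc_basis : nat -> set nat;
  csc_k : nat -> nat -> nat -> nat;
  csc_basis_sub : forall n, csc_basis n `<=` csc_points;
  csc_basis_cover : csc_points `<=` \bigcup_n csc_basis n;
  csc_kP : forall x m n, csc_points x ->
    (csc_basis m `&` csc_basis n) x ->
    csc_basis (csc_k x m n) x /\
    csc_basis (csc_k x m n) `<=` csc_basis m `&` csc_basis n
}.

Definition computable_csc (T : csc_space) : Prop :=
  [/\ computable_set (csc_points T),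
      uniformly_computable (csc_basis T) &
      exists f : 3.-tuple nat -> nat, recursive f /\
        forall x m n, csc_points T x -> f [tuple x; m; n] = csc_k T x m n].

Definition infinite_csc (T : csc_space) : Prop := infinite_set (csc_points T).

Definition T1_csc (T : csc_space) : Prop :=
  forall x y, csc_points T x -> csc_points T y -> x <> y ->
  exists m n, (csc_basis T m `\` csc_basis T n) x /\
              (csc_basis T n `\` csc_basis T m) y.

Section Subspace.
Variables (T : csc_space) (Y : set nat).

Definition sub_basis (n : nat) : set nat := csc_basis T n `&` Y.

Definition sub_basic_open (V : set nat) : Prop := exists n, V = sub_basis n.

Definition sub_open (V : set nat) : Prop :=
  exists I : set nat, V = \bigcup_(n in I) sub_basis n.

Definition discrete_subspace : Prop :=
  forall x, Y x -> sub_basic_open [set x].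

(* The condition concerns all sets generated by the basis, not the basis
   itself: on the natural numbers, the sets {x} `|` [n, +oo[ form a basis of the
   cofinite topology that omits the empty set and many cofinite sets, and so do
   their traces on any infinite subset. *)
Definition cofinite_subspace : Prop :=
  infinite_set Y /\
  forall V, V `<=` Y -> (sub_open V <-> V = set0 \/ finite_set (Y `\` V)).

End Subspace.

(* Main.v *)
(* If X has infinitely many isolated points, they form a Sigma^0_2 discrete
   subspace, which has an infinite Delta^0_2 subset.  Otherwise let Z be X minus
   an initial segment containing the isolated points; by T_1 every basic open
   set meeting Z meets it in an infinite set.  If inside some basic U_m meeting
   Z any two nonempty basic open sets meet, then any finitely many of them have
   infinite intersection, and one enumerates computably an increasing sequence
   almost all of whose terms lie in each U_n already seen to meet U_m and Z;
   its range is a cofinite subspace.  Otherwise each basic open set meeting Z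
   contains two that meet Z and are disjoint on Z.  Finding them is a Pi^0_1
   matter, so 0' iterates this, each time taking a large point in one of the two
   sets and continuing inside the other; the points chosen form a discrete
   subspace. *)
Require Import Defs.
From HB Require Import structures.
From mathcomp Require Import all_boot.
From mathcomp Require Import boolp classical_sets functions cardinality.
From mathcomp Require Import zify.

Local Open Scope classical_set_scope.

(** * Closure properties of the total recursive functions *)

(* Arguments are read off a list through [head] and [behead], as de Bruijn
   indices: the lemmas below, bounded quantifiers included, are then
   syntax-directed. *)
Definition rec_env n (F : seq nat -> nat) : Prop :=
  recursive (fun v : n.-tuple nat => F v).

Lemma recursive_ext n (f g : n.-tuple nat -> nat) :
  f =1 g -> recursive f -> recursive g.
Proof. by move=> /funext->. Qed.

Lemma rec_env_ext n F G : F =1 G -> rec_env n F -> rec_env n G.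
Proof. by move=> /funext->. Qed.

Lemma rec_env_head n : rec_env n.+1 (fun w => head 0 w).
Proof.
apply: (recursive_ext _ _ _ _ (rec_proj ord0)) => v.
by rewrite (tnth_nth 0) nth0.
Qed.

Lemma rec_env_behead n F :
  rec_env n F -> rec_env n.+1 (fun w => F (behead w)).
Proof.
move=> rF.
apply: (rec_comp (g := fun i (w : n.+1.-tuple nat) => tnth w (lift ord0 i)) rF).
  by move=> i; exact: rec_proj.
move=> v; congr F; rewrite -[RHS]/(tval [tuple tnth v (lift ord0 i) | i < n]).
rewrite -[LHS]/(tval [tuple of behead v]); congr tval.
by apply: eq_from_tnth => i; rewrite tnth_mktuple tnth_behead; congr tnth;
  apply: val_inj; rewrite /= inordK // ltnS.
Qed.

(** Composition in which only the new head entry is computed, by [B]; the other entries are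
    projections. *)
Lemma rec_env_subst n (H : nat -> seq nat -> nat) B :
  rec_env n.+1 (fun w => H (head 0 w) (behead w)) -> rec_env n B ->
  rec_env n (fun v => H (B v) v).
Proof.
move=> rH rB.
apply: (rec_comp (g := fun i (v : n.-tuple nat) =>
  if unlift ord0 i is Some j then tnth v j else B v) rH).
  by move=> i; case: (unlift ord0 i) => [j|]; [exact: rec_proj|exact: rB].
move=> v; set w := [tuple _ | _ < _].
have -> : w = [tuple of B v :: v].
  apply: eq_from_tnth => i; rewrite tnth_mktuple.
  by case: unliftP => [j|] ->; rewrite ?tnthS ?tnth0.
by [].
Qed.

Lemma rec_env_S n A : rec_env n A -> rec_env n (fun v => (A v).+1).
Proof.
move=> rA; apply: (rec_comp (g := fun _ v => A v) rec_succ) => // v.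
by rewrite tnth_mktuple.
Qed.

Lemma rec_env_const n c : rec_env n (fun=> c).
Proof. by elim: c => [|c IH]; [exact: rec_zero|exact: rec_env_S]. Qed.

Lemma rec_env_prec n (h : nat -> seq nat -> nat) f g B :
  rec_env n f ->
  rec_env n.+2 (fun w => g (head 0 w) (head 0 (behead w)) (behead (behead w))) ->
  rec_env n B ->
  (forall v, h 0 v = f v) -> (forall j v, h j.+1 v = g j (h j v) v) ->
  rec_env n (fun v => h (B v) v).
Proof.
move=> rf rg rB h0 hS; apply: rec_env_subst rB.
by apply: (rec_prec rf rg) => [v|j v] /=; rewrite ?h0 ?hS.
Qed.

Lemma rec_env_min n (P : nat -> seq nat -> bool) m :
  rec_env n.+1 (fun w => ~~ P (head 0 w) (behead w)) ->
  (forall v, P (m v) v) -> (forall v y, P y v -> m v <= y) -> rec_env n m.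
Proof.
move=> rP mP mmin; apply: (rec_min rP) => [v|v y] /=; first by rewrite mP.
by case: (boolP (P y v)) => // /mmin; rewrite leqNgt => /negbTE->.
Qed.

(** Quantifying over the substituted arguments builds composition into the notion, so that a
    hypothesis of this form serves directly as a rule for [rec_env_tac]. *)
Definition recursive1 (f : nat -> nat) : Prop :=
  forall n A, rec_env n A -> rec_env n (fun v => f (A v)).

Definition recursive2 (f : nat -> nat -> nat) : Prop :=
  forall n A B, rec_env n A -> rec_env n B -> rec_env n (fun v => f (A v) (B v)).

Definition recursive3 (f : nat -> nat -> nat -> nat) : Prop :=
  forall n A B C, rec_env n A -> rec_env n B -> rec_env n C ->
  rec_env n (fun v => f (A v) (B v) (C v)).

Lemma recursive1P (f : nat -> nat) :
  recursive (fun v : 1.-tuple nat => f (tnth v ord0)) -> recursive1 f.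
Proof.
move=> rf n A rA; apply: (rec_comp (g := fun _ v => A v) rf) => // v.
by rewrite tnth_mktuple.
Qed.

Lemma recursive2P (f : nat -> nat -> nat) :
  recursive (fun v : 2.-tuple nat => f (nth 0 v 0) (nth 0 v 1)) -> recursive2 f.
Proof.
move=> rf n A B rA rB.
apply: (rec_comp (g := fun i v => if val i == 0 then A v else B v) rf).
  by move=> i; case: eqP.
move=> v; set w := [tuple _ | _ < _].
by have -> : w = [tuple A v; B v]
  by apply: eq_from_tnth => -[[|[|i]] Hi]; rewrite tnth_mktuple // (tnth_nth 0).
Qed.

Lemma rec_env_addn : recursive2 addn.
Proof.
move=> n A B rA rB.
apply: (@rec_env_prec n (fun j v => A v + j) A (fun j x v => x.+1)) => //=.
- exact/rec_env_S/rec_env_behead/rec_env_head.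
- by move=> v; rewrite addn0.
- by move=> j v; rewrite addnS.
Qed.

Lemma rec_env_muln : recursive2 muln.
Proof.
move=> n A B rA rB.
apply: (@rec_env_prec n (fun j v => A v * j) (fun=> 0) (fun j x v => A v + x)) => //=.
- exact: rec_env_const.
- apply: rec_env_addn; last exact/rec_env_behead/rec_env_head.
  exact/(rec_env_behead _ (fun w => A (behead w)))/rec_env_behead.
- by move=> v; rewrite muln0.
- by move=> j v; rewrite mulnS.
Qed.

Lemma rec_env_predn : recursive1 predn.
Proof.
move=> n A rA.
apply: (@rec_env_prec n (fun j v => j.-1) (fun=> 0) (fun j x v => j)) => //=.
- exact: rec_env_const.
- exact: rec_env_head.
Qed.

Lemma rec_env_subn : recursive2 subn.
Proof.
move=> n A B rA rB.
apply: (@rec_env_prec n (fun j v => A v - j) A (fun j x v => x.-1)) => //=.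
- exact/rec_env_predn/rec_env_behead/rec_env_head.
- by move=> v; rewrite subn0.
- by move=> j v; rewrite subnS.
Qed.

Lemma rec_env_not n (P : seq nat -> bool) :
  rec_env n (fun v => P v) -> rec_env n (fun v => ~~ P v).
Proof.
move=> rP; apply: rec_env_ext (rec_env_subn _ _ _ (rec_env_const n 1) rP) => v.
by case: (P v).
Qed.

Lemma rec_env_and n (P Q : seq nat -> bool) :
  rec_env n (fun v => P v) -> rec_env n (fun v => Q v) ->
  rec_env n (fun v => P v && Q v).
Proof.
move=> rP rQ; apply: rec_env_ext (rec_env_muln _ _ _ rP rQ) => v.
by rewrite mulnb.
Qed.

Lemma rec_env_imply n (P Q : seq nat -> bool) :
  rec_env n (fun v => P v) -> rec_env n (fun v => Q v) ->
  rec_env n (fun v => P v ==> Q v).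
Proof.
move=> rP rQ.
apply: rec_env_ext (rec_env_not _ _ (rec_env_and _ _ _ rP (rec_env_not _ _ rQ))).
by move=> v /=; rewrite negb_and negbK implybE.
Qed.

Lemma rec_env_leq : recursive2 (fun x y => x <= y).
Proof.
move=> n A B rA rB.
apply: rec_env_ext (rec_env_subn _ _ _ (rec_env_const n 1)
  (rec_env_subn _ _ _ rA rB)) => v /=.
by rewrite -subn_eq0; case: (A v - B v).
Qed.

Lemma rec_env_eqn : recursive2 (fun x y => x == y).
Proof.
move=> n A B rA rB.
apply: rec_env_ext (rec_env_and _ _ _ (rec_env_leq _ _ _ rA rB)
  (rec_env_leq _ _ _ rB rA)) => v /=.
by rewrite -eqn_leq.
Qed.

(** In a primitive recursion the second entry is the previous value; it is dropped here for
    predicates of the counter and the parameters alone. *)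
Lemma rec_env_skip n F :
  rec_env n.+1 F ->
  rec_env n.+2 (fun w => F (head 0 w :: behead (behead w))).
Proof.
move=> rF.
apply: (rec_comp (g := fun i (w : n.+2.-tuple nat) =>
  tnth w (if unlift ord0 i is Some j then lift ord0 (lift ord0 j) else ord0)) rF).
  by move=> i; exact: rec_proj.
case; case=> [//|a [//|b s]] sz; set v := Tuple _; set w := [tuple _ | _ < _].
have szs : size s == n by [].
have -> // : w = [tuple of a :: Tuple szs].
apply: eq_from_tnth => i; rewrite tnth_mktuple.
case: unliftP => [j|] ->; rewrite ?tnthS ?tnth0 !(tnth_nth 0) //=.
Qed.

(** Recursion on the bound: a search below [j] returns [j] on failure, so the value grows at step
    [j] exactly when it equals [j] and [P j] fails. *)
Lemma rec_env_find n (P : nat -> seq nat -> bool) B :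
  rec_env n.+1 (fun w => P (head 0 w) (behead w)) -> rec_env n B ->
  rec_env n (fun v => find (P^~ v) (iota 0 (B v))).
Proof.
move=> rP rB.
apply: (@rec_env_prec n (fun j v => find (P^~ v) (iota 0 j))
  (fun=> 0) (fun j x v => x + ((x == j) && ~~ P j v))) => //.
- exact: rec_env_const.
- apply: rec_env_addn; first exact/rec_env_behead/rec_env_head.
  apply: rec_env_and.
    apply: rec_env_eqn; last exact/rec_env_head.
    exact/rec_env_behead/rec_env_head.
  by apply: rec_env_not; exact: (rec_env_skip _ _ rP).
- move=> j v; rewrite -addn1 iotaD find_cat /= add0n has_find size_iota.
  have := find_size (P^~ v) (iota 0 j); rewrite size_iota.
  by case: ltngtP => //= [|->] _; [rewrite addn0|case: (P j v)].
Qed.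

Lemma rec_env_has n (P : nat -> seq nat -> bool) B :
  rec_env n.+1 (fun w => P (head 0 w) (behead w)) -> rec_env n B ->
  rec_env n (fun v => has (P^~ v) (iota 0 (B v))).
Proof.
move=> rP rB.
apply: rec_env_ext
  (rec_env_leq _ _ _ (rec_env_S _ _ (rec_env_find _ _ _ rP rB)) rB) => v /=.
by rewrite has_find size_iota.
Qed.

Lemma rec_env_all n (P : nat -> seq nat -> bool) B :
  rec_env n.+1 (fun w => P (head 0 w) (behead w)) -> rec_env n B ->
  rec_env n (fun v => all (P^~ v) (iota 0 (B v))).
Proof.
move=> rP rB.
have /rec_env_not := rec_env_has n (fun b v => ~~ P b v) B (rec_env_not _ _ rP) rB.
by apply: rec_env_ext => v; rewrite -all_predC (eq_all (a2 := P^~ v)) // => b /=;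
  rewrite negbK.
Qed.

Ltac rec_env_tac :=
  cbv beta;
  lazymatch goal with
  | |- rec_env _ (fun w => head 0 w) => apply: rec_env_head
  | |- rec_env _ (head 0) => apply: rec_env_head
  | |- rec_env _ (fun w => ?A (behead w)) => apply: (rec_env_behead _ A)
  | |- rec_env _ (fun w => ?A (behead (behead w))) =>
      refine (rec_env_behead _ (fun u => A (behead u)) _)
  | |- rec_env _ (fun w => ?A (behead (behead (behead w)))) =>
      refine (rec_env_behead _ (fun u => A (behead (behead u))) _)
  | |- rec_env _ (fun w => ?A (behead (behead (behead (behead w))))) =>
      refine (rec_env_behead _ (fun u => A (behead (behead (behead u)))) _)
  | |- rec_env _ (fun w => nat_of_bool (?A (behead w))) =>
      apply: (rec_env_behead _ A)
  | |- rec_env _ (fun w => nat_of_bool (_ && _)) => apply: rec_env_and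
  | |- rec_env _ (fun w => nat_of_bool (_ ==> _)) => apply: rec_env_imply
  | |- rec_env _ (fun w => nat_of_bool (~~ _)) => apply: rec_env_not
  | |- rec_env _ (fun w => nat_of_bool (_ == _)) => apply: rec_env_eqn
  | |- rec_env _ (fun w => nat_of_bool (_ <= _)) => apply: rec_env_leq
  | |- rec_env _ (fun w => nat_of_bool (all _ (iota 0 _))) => apply: rec_env_all
  | |- rec_env _ (fun w => nat_of_bool (has _ (iota 0 _))) => apply: rec_env_has
  | |- rec_env _ (fun w => find _ (iota 0 _)) => apply: rec_env_find
  | |- rec_env _ (fun w => _ + _) => apply: rec_env_addn
  | |- rec_env _ (fun w => _ * _) => apply: rec_env_muln
  | |- rec_env _ (fun w => (_).+1) => apply: rec_env_S
  | H : recursive3 ?f |- rec_env _ (fun w => ?f _ _ _) => apply: H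
  | H : recursive3 (fun x y z => nat_of_bool (?f x y z))
      |- rec_env _ (fun w => nat_of_bool (?f _ _ _)) => apply: H
  | H : recursive2 ?f |- rec_env _ (fun w => ?f _ _) => apply: H
  | H : recursive2 (fun x y => nat_of_bool (?f x y))
      |- rec_env _ (fun w => nat_of_bool (?f _ _)) => apply: H
  | H : recursive1 ?f |- rec_env _ (fun w => ?f _) => apply: H
  | H : recursive1 (fun x => nat_of_bool (?f x))
      |- rec_env _ (fun w => nat_of_bool (?f _)) => apply: H
  | H : rec_env ?n ?A |- rec_env ?n (fun w => ?A w) => exact: H
  | H : rec_env ?n ?A |- rec_env ?n ?A => exact: H
  | |- rec_env _ (fun w => _) => apply: rec_env_const
  end.

(** * A recursive pairing function *)

Definition pairn x y := (x + y) * (x + y) + x.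

(** Components are at most the code, so a bounded search suffices; on a number that is not a code it
    returns the default [p.+1]. *)
Definition fstn p :=
  find (fun x => has (fun y => pairn x y == p) (iota 0 p.+1)) (iota 0 p.+1).

Definition sndn p :=
  find (fun y => has (fun x => pairn x y == p) (iota 0 p.+1)) (iota 0 p.+1).

(** The gap from $(x+y)^2$ to the next square exceeds [x], so the code determines [x + y]. *)
Lemma pairn_inj x y x' y' : pairn x y = pairn x' y' -> x = x' /\ y = y'.
Proof.
rewrite /pairn => e.
have : x + y = x' + y'.
  have := leq_addl y x; have := leq_addl y' x'.
  case: (ltngtP (x + y) (x' + y')) => //; nia.
nia.
Qed.

Lemma pairn_ge x y : x <= pairn x y /\ y <= pairn x y.
Proof. rewrite /pairn; split; nia. Qed.

Lemma find_iota (P : pred nat) t m :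
  m < t -> P m -> (forall j, j < m -> ~~ P j) -> find P (iota 0 t) = m.
Proof.
move=> mt Pm min; have hP : has P (iota 0 t).
  by apply/hasP; exists m => //; rewrite mem_iota.
have := nth_find 0 hP; move: (hP); rewrite has_find size_iota => ft.
rewrite nth_iota // add0n => Pf.
case: (ltngtP (find P (iota 0 t)) m) => // [/min|mf]; first by rewrite Pf.
by have := before_find 0 mf; rewrite nth_iota // add0n Pm.
Qed.

Lemma pairnK1 x y : fstn (pairn x y) = x.
Proof.
have [xp yp] := pairn_ge x y; apply: find_iota => //.
  by apply/hasP; exists y => //; rewrite mem_iota.
move=> j jx; apply/hasPn => z _; apply/eqP => /pairn_inj[jE _].
by rewrite jE ltnn in jx.
Qed.

Lemma pairnK2 x y : sndn (pairn x y) = y.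
Proof.
have [xp yp] := pairn_ge x y; apply: find_iota => //.
  by apply/hasP; exists x => //; rewrite mem_iota.
move=> j jy; apply/hasPn => z _; apply/eqP => /pairn_inj[_ jE].
by rewrite jE ltnn in jy.
Qed.

Lemma recursive_fstn : recursive1 fstn.
Proof. by move=> n A rA; rewrite /fstn /pairn; repeat rec_env_tac. Qed.

Lemma recursive_sndn : recursive1 sndn.
Proof. by move=> n A rA; rewrite /sndn /pairn; repeat rec_env_tac. Qed.

(** * $\Delta^0_2$ sets as limits and along chains *)

Lemma Delta02_limit (f : nat -> nat -> bool) (A : set nat) :
  recursive2 f ->
  (forall x, A x -> exists a, forall t, a <= t -> f x t) ->
  (forall x, ~ A x -> exists a, forall t, a <= t -> ~~ f x t) ->
  Delta02 A.
Proof.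
move=> rf fA fnA.
(* The sum of the last two entries runs through all stages from a given one on, so one matrix
   expresses both [eventually true] and [true at arbitrarily late stages]. *)
pose chi (v : 3.-tuple nat) :=
  f (head 0 v) (head 0 (behead v) + head 0 (behead (behead v))).
have chiP : computable_rel [set v | chi v].
  exists chi; split=> //.
  by suff: rec_env 3 (fun v => f (head 0 v)
    (head 0 (behead v) + head 0 (behead (behead v)))) by []; repeat rec_env_tac.
split; exists [set v | chi v]; split=> // x; rewrite /chi /=; split.
- by move=> /fA[a fa]; exists a => b; rewrite fa // leq_addr.
- move=> [a fa]; apply: contrapT => /fnA[b fb].
  by have := fb (a + b) (leq_addl _ _); rewrite fa.
- by move=> /fA[a fa] b; exists a; rewrite fa // leq_addl.
- move=> fx; apply: contrapT => /fnA[a fa].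
  by have [b] := fx a; apply/negP/fa/leq_addr.
Qed.

Lemma eventually_forall_lt (Q : nat -> nat -> Prop) m :
  (forall j, j < m -> exists a, forall t, a <= t -> Q j t) ->
  exists a, forall t, a <= t -> forall j, j < m -> Q j t.
Proof.
elim: m => [|m IH] Qm; first by exists 0.
have [a aP] := IH (fun j jm => Qm j (ltnW jm)).
have [b bP] := Qm m (ltnSn m).
exists (maxn a b) => t; rewrite geq_max => /andP[at_ bt] j.
by rewrite ltnS leq_eqVlt => /orP[/eqP->|/aP]; [exact: bP|exact].
Qed.

Lemma homo_ge (y : nat -> nat) : (forall i, y i < y i.+1) -> forall i, i <= y i.
Proof. by move=> yS; elim=> // i /leq_ltn_trans; apply. Qed.

Lemma unbounded_infinite (A : set nat) :
  (forall N, exists2 x, A x & N <= x) -> infinite_set A.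
Proof.
move=> Aunb /finite_seqP[s As].
have [x Ax xs] := Aunb (\max_(y <- s) y).+1.
have : x \in s by move: Ax; rewrite As.
by move=> /leq_bigmax_seq/(_ isT)/(leq_trans xs); rewrite ltnn.
Qed.

Lemma infinite_unbounded (A : set nat) :
  infinite_set A -> forall N, exists2 x, A x & N <= x.
Proof.
move=> Ainf N; apply: contrapT => noA; apply: Ainf.
apply: sub_finite_set (finite_II N) => x Ax /=.
by rewrite ltnNge; apply/negP => Nx; apply: noA; exists x.
Qed.

(* 0' can follow a Pi^0_1 relation by taking least successors.  Stage [t] of the
   approximation replaces the quantifier over [b] by [b < t]; it is right in the
   limit on each initial segment of the chain, and as [fstn] increases along
   the chain, a segment of length [x.+2] decides membership of [x]. *)
Lemma Delta02_chain (chi : nat -> nat -> nat -> bool) (good : nat -> Prop) s0 :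
  recursive3 chi -> good s0 ->
  (forall s, good s -> exists s', forall b, chi s s' b) ->
  (forall s s', good s -> (forall b, chi s s' b) -> good s' /\ fstn s < fstn s') ->
  exists g : nat -> nat,
    [/\ forall i, good (g i), forall i b, chi (g i) (g i.+1) b,
        forall i, fstn (g i) < fstn (g i.+1) &
        Delta02 (range (fun i => fstn (g i.+1)))].
Proof.
move=> rchi good0 ex next.
pose appr (t : nat) (s : nat) :=
  find (fun s' => all (fun b => chi s s' b) (iota 0 t)) (iota 0 t).
(* The least successor is the limit of the bounded searches in [appr]; the default outside [good]
   makes the choice function total. *)
have exb s : exists s', good s ->
    (forall b, chi s s' b) /\ forall j, j < s' -> exists b, ~~ chi s j b.
  have [gs|] := pselect (good s); last by exists 0.
  have ex' : exists s', `[< forall b, chi s s' b >].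
    by have [s' ?] := ex s gs; exists s'; apply/asboolP.
  exists (ex_minn ex') => _; case: ex_minnP => s' /asboolP sP smin.
  split=> // j js; apply: contrapT => nb.
  suff /asboolP/smin : forall b, chi s j b by rewrite leqNgt js.
  by move=> b; apply: contrapT => /negP cb; apply: nb; exists b.
have [h hP] := choice exb.
pose g i := iter i h s0.
have gg i : good (g i).
  by elim: i => //= i IH; have [hi _] := hP _ IH; have [] := next _ _ IH hi.
have gchi i b : chi (g i) (g i.+1) b by have [] := hP _ (gg i).
have glt i : fstn (g i) < fstn (g i.+1) by have [] := next _ _ (gg i) (gchi i).
exists g; split=> //.
pose G t i := iter i (appr t) s0.
have rG : recursive2 G.
  move=> n A B rA rB.
  apply: (@rec_env_prec n (fun j v => G (A v) j) (fun=> s0)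
    (fun j x v => appr (A v) x)) => //.
    exact: rec_env_const.
  by rewrite /appr; repeat rec_env_tac.
have Glim i : exists a, forall t, a <= t -> G t i = g i.
  elim: i => [|i [a aP]]; first by exists 0.
  have [gb gmin] := hP _ (gg i).
  (* Each of the finitely many candidates below the true successor is refuted by some [b], hence
     rejected at all late stages. *)
  have [|b bP] := @eventually_forall_lt
    (fun j t => ~~ all (fun b => chi (g i) j b) (iota 0 t)) (g i.+1).
    move=> j /gmin[b nb]; exists b.+1 => t bt; apply/allPn; exists b => //.
    by rewrite mem_iota.
  exists (maxn a (maxn b (g i.+1).+1)) => t; rewrite !geq_max => /and3P[at_ bt gt].
  rewrite [LHS]/= -/(G t i) aP // /appr; apply: find_iota => //.
    by apply/allP => c _; exact: gb.
  by move=> j /(bP _ bt).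
have yge := homo_ge (fun i => fstn (g i)) glt.
have Glim' x : exists a, forall t, a <= t -> forall i, i < x.+2 -> G t i = g i.
  by apply: eventually_forall_lt => i _; exact: Glim.
have rf : recursive1 fstn := recursive_fstn.
apply: (@Delta02_limit
  (fun x t => has (fun i => fstn (G t i.+1) == x) (iota 0 x.+1))) => [|x|x].
- by move=> n A B rA rB; repeat rec_env_tac.
- move=> [i _ ix]; have [a aP] := Glim' x; exists a => t /aP Gt.
  have ilt : i < x.+1 by rewrite -ix ltnW // ltnS yge.
  by apply/hasP; exists i; rewrite ?mem_iota // Gt // ix.
- move=> nx; have [a aP] := Glim' x; exists a => t /aP Gt.
  apply/hasPn => i; rewrite mem_iota add0n => /andP[_ ix].
  by rewrite Gt //; apply/eqP => e; apply: nx; exists i.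
Qed.

(** * Isolated points *)

Lemma T1_shrink (T : csc_space) (TT1 : T1_csc T) (s : seq nat) m x :
  csc_basis T m x ->
  exists n, [/\ csc_basis T n x, csc_basis T n `<=` csc_basis T m &
                forall y, y \in s -> csc_basis T n y -> y = x].
Proof.
move=> mx; have Xx := csc_basis_sub mx.
elim: s => [|z s [n [nx nm ns]]]; first by exists m; split=> // ?.
have [[nz zx]|nz] := pselect (csc_basis T n z /\ z <> x); last first.
  exists n; split=> // y; rewrite in_cons => /orP[/eqP-> ny|]; last exact: ns.
  by apply: contrapT => yx; apply: nz.
(* Intersecting with a basic set that contains [x] but not [z] removes [z]. *)
have [a [b [[ax _] [_ az]]]] := TT1 x z Xx (csc_basis_sub nz) (nesym zx).
have [kx ksub] := @csc_kP T x n a Xx (conj nx ax).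
exists (csc_k T x n a); split=> //.
  by move=> y /ksub[/nm].
move=> y; rewrite in_cons => /orP[/eqP->|ys] /ksub[ny ay].
  by case: az.
exact: ns.
Qed.

(** Shrink around [x] away from a list of all points of the finite set. Hence every basic set
    containing a non-isolated point is infinite. *)
Lemma finite_basis_isolated (T : csc_space) (TT1 : T1_csc T) m x :
  finite_set (csc_basis T m) -> csc_basis T m x ->
  exists n, csc_basis T n = [set x].
Proof.
move=> /finite_seqP[s ms] mx.
have [n [nx nm ns]] := @T1_shrink T TT1 s m x mx.
exists n; apply/seteqP; split=> y; last by move=> ->.
by move=> ny; apply: (ns y _ ny); have := nm _ ny; rewrite ms.
Qed.

(** A state pairs a point with an index whose basic set is its singleton, a $\Pi^0_1$ condition. A
    larger isolated point always exists, so the chain never stops. *)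
Lemma isolated_case (T : csc_space) (u : nat -> nat -> bool) :
  recursive2 u -> (forall n x, csc_basis T n x <-> u n x) ->
  infinite_set [set x | exists n, csc_basis T n = [set x]] ->
  exists Y : set nat, [/\ Y `<=` csc_points T, infinite_set Y, Delta02 Y &
                          discrete_subspace T Y].
Proof.
move=> ru uP isoinf.
pose chi s s' b := [&& (fstn s).+1 <= fstn s', u (sndn s') (fstn s') &
                       u (sndn s') b ==> (b == fstn s')].
(* The seed [0] need not describe an isolated point; the range starts at the next state. *)
have [|//|||g [_ gchi glt gD]] := @Delta02_chain chi setT 0.
- have := (recursive_fstn, recursive_sndn) => -[rf rs].
  by move=> n A B C rA rB rC; rewrite /chi; repeat rec_env_tac.
- move=> s _; have [x [n nx] sx] := infinite_unbounded _ isoinf (fstn s).+1.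
  exists (pairn x n) => b; rewrite /chi pairnK1 pairnK2 sx /=; apply/andP; split.
    by apply/uP; rewrite nx.
  by apply/implyP => /uP; rewrite nx => /= ->.
- by move=> s s' _ /(_ 0) /and3P[].
have giso i : csc_basis T (sndn (g i.+1)) = [set fstn (g i.+1)].
  apply/seteqP; split=> [x /uP ux|x ->].
    by have /and3P[_ _] := gchi i x; rewrite ux => /eqP.
  by have /and3P[_ /uP] := gchi i 0.
exists (range (fun i => fstn (g i.+1))); split=> //.
- by move=> _ [i _ <-]; apply: (@csc_basis_sub T (sndn (g i.+1))); rewrite giso.
- apply: unbounded_infinite => N; exists (fstn (g N.+1)); first by exists N.
  exact: (homo_ge (fun i => fstn (g i.+1))).
- move=> _ [i _ <-]; exists (sndn (g i.+1)); rewrite /sub_basis giso.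
  by apply/seteqP; split=> [x ->|x []]; [split=> //; exists i|].
Qed.

(** * Computable sets and the cofinite topology *)

Lemma computable_setP (f : nat -> bool) (A : set nat) :
  recursive1 f -> (forall x, A x <-> f x) -> computable_set A.
Proof.
move=> rf Af; exists (fun v => f (tnth v ord0)); split=> [|v]; last exact: Af.
apply: (recursive_ext _ _ _ _ (rf 1 _ (rec_env_head 0))) => v.
by rewrite (tnth_nth 0) nth0.
Qed.

(** Since [i <= h i], a value [x] can occur only at an index up to [x]. *)
Lemma computable_range (h : nat -> nat) :
  recursive1 h -> (forall i, h i < h i.+1) -> computable_set (range h).
Proof.
move=> rh hS.
apply: (@computable_setP (fun x => has (fun i => h i == x) (iota 0 x.+1))).
  by move=> n A rA; repeat rec_env_tac.
move=> x; split=> [[i _ <-]|/hasP[i _ /eqP<-]]; last by exists i.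
by apply/hasP; exists i; rewrite ?mem_iota //= ltnS (homo_ge h hS).
Qed.

Definition hyperconnected (T : csc_space) (Z : set nat) : Prop :=
  forall a b, csc_basis T a `&` Z !=set0 -> csc_basis T b `&` Z !=set0 ->
  csc_basis T a `&` csc_basis T b `&` Z !=set0.

(** A nonempty open set contains a nonempty basic trace, so it is cofinite. Conversely, [T1_shrink]
    gives each point of a cofinite [V] a basic neighbourhood avoiding the finitely many points of
    [Y] outside [V]. *)
Lemma cofinite_of_almost_contained (T : csc_space) (TT1 : T1_csc T) (Y : set nat) :
  Y `<=` csc_points T -> infinite_set Y ->
  (forall n, csc_basis T n `&` Y !=set0 -> finite_set (Y `\` csc_basis T n)) ->
  cofinite_subspace T Y.
Proof.
move=> YX Yinf Yfin; split=> // V VY; split=> [[I VI]|].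
  have [V0|/set0P[x Vx]] := eqVneq V set0; [by left|right].
  have := Vx; rewrite {1}VI => -[n In nx].
  apply: sub_finite_set (Yfin n _); last by exists x.
  move=> y [Yy nVy]; split=> // ny; apply: nVy; rewrite VI.
  by exists n.
move=> Vco; exists [set n | sub_basis T Y n `<=` V].
apply/seteqP; split=> [x Vx|x [n nV]]; last exact: nV.
case: Vco => [V0|/finite_seqP[s sP]]; first by rewrite V0 in Vx.
have [m _ mx] := csc_basis_cover (YX _ (VY _ Vx)).
have [n [nx _ ns]] := @T1_shrink T TT1 s m x mx.
exists n; last by split=> //; exact: VY.
move=> y [ny Yy]; apply: contrapT => nVy.
have ys : y \in s by have : (Y `\` V) y by []; rewrite sP.
by apply: nVy; rewrite (ns y ys ny).
Qed.

(** * A computable set that each basic set meets in infinitely many points or not at all *)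

Section Perfect.
Variables (T : csc_space) (TT1 : T1_csc T).
Variables (u : nat -> nat -> bool) (z : nat -> bool).
Hypotheses (ru : recursive2 u) (uP : forall n x, csc_basis T n x <-> u n x).
Hypotheses (rz : recursive1 z) (zX : forall x, z x -> csc_points T x).
Hypothesis zperf : forall n x, u n x -> z x ->
  forall N, exists y, [/\ u n y, z y & N <= y].

Lemma basis_meet a b x : u a x -> u b x ->
  exists c, u c x /\ forall y, u c y -> u a y /\ u b y.
Proof.
move=> /uP ax /uP bx; exists (csc_k T x a b).
have [|/uP-> ksub] := @csc_kP T x a b (csc_basis_sub ax); first by split.
by split=> // y /uP /ksub[/uP-> /uP->].
Qed.

Lemma hyperconnected_case m : csc_basis T m `&` [set x | z x] !=set0 ->
  hyperconnected T (csc_basis T m `&` [set x | z x]) ->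
  exists Y : set nat,
    [/\ Y `<=` csc_points T, infinite_set Y, computable_set Y &
        cofinite_subspace T Y].
Proof.
move=> [x0 [/uP mx0 zx0]] hyper.
(* A decidable stage of the $\Sigma^0_1$ fact that [U_n] meets $U_m \cap Z$. *)
pose act s n := has (fun w => [&& z w, u m w & u n w]) (iota 0 s).
have actP s n : act s n -> csc_basis T n `&` (csc_basis T m `&` [set x | z x]) !=set0.
  by move=> /hasP[w _ /and3P[zw /uP mw /uP nw]]; exists w.
pose ok s c d := [&& c.+1 <= d, z d, u m d &
  all (fun n => act s n ==> u n d) (iota 0 s)].
have exd p : exists d, ok p.2 p.1 d.
  case: p => c s /=.
  (* By hyperconnectedness the active sets can be intersected one at a time, keeping a basic set
     that meets [Z]. *)
  have /(_ s)[k [[x [kx zx]] km ks]] r : exists k, [/\ exists x, u k x /\ z x,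
      forall y, u k y -> u m y &
      forall n, n < r -> act s n -> forall y, u k y -> u n y].
    elim: r => [|j [k [[x [kx zx]] km ks]]].
      by exists m; split=> //; exists x0.
    have [aj|naj] := boolP (act s j); last first.
      exists k; split=> //; first by exists x.
      move=> n; rewrite ltnS leq_eqVlt => /orP[/eqP-> aj|]; last exact: ks.
      by rewrite aj in naj.
    have [|y [[/uP ky /uP jy] [_ zy]]] := hyper k j _ (actP _ _ aj).
      by exists x; split; [exact/uP|split=> //; apply/uP/km].
    have [l [ly lsub]] := basis_meet _ _ _ ky jy.
    exists l; split; [by exists y|by move=> t /lsub[/km]|].
    move=> n; rewrite ltnS leq_eqVlt => /orP[/eqP-> _|/ks kn /kn {}kn] t /lsub[]//.
    by move=> /kn.
  have [d [kd zd cd]] := zperf _ _ kx zx c.+1.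
  exists d; rewrite /ok cd zd km //=; apply/allP => n; rewrite mem_iota => /= ns.
  by apply/implyP => an; exact: ks kd.
pose next c s := ex_minn (exd (c, s)).
have nextP c s : ok s c (next c s) by rewrite /next; case: ex_minnP.
have rnext : recursive2 next.
  move=> n A B rA rB.
  apply: (@rec_env_min n (fun d v => ok (B v) (A v) d)) => [|v|v y].
  - by rewrite /ok /act; repeat rec_env_tac.
  - exact: nextP.
  - by rewrite /next; case: ex_minnP => d _; apply.
pose h := fix h j := if j is i.+1 then next (h i) i else 0.
have rh : recursive1 h.
  move=> n A rA.
  apply: (@rec_env_prec n (fun j v => h j) (fun=> 0) (fun j x v => next x j)) => //.
    exact: rec_env_const.
  by repeat rec_env_tac.
have hS i : h i < h i.+1 by have /and4P[] := nextP (h i) i.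
(* The start value [h 0 = 0] is only a lower bound and need not lie in the space. *)
pose h' i := h i.+1.
have hX i : z (h' i) /\ csc_basis T m (h' i).
  by have /and4P[_ ? ? _] := nextP (h i) i; split=> //; exact/uP.
have Yinf : infinite_set (range h').
  apply: unbounded_infinite => N; exists (h' N); first by exists N.
  exact: (homo_ge h' (fun i => hS i.+1)).
exists (range h'); split=> //.
- by move=> _ [i _ <-]; apply: zX; have [] := hX i.
- apply: computable_range => [n A rA|i]; last exact: hS.
  by apply: rh; exact: rec_env_S.
apply: cofinite_of_almost_contained => //.
  by move=> _ [i _ <-]; apply: zX; have [] := hX i.
move=> n [x [nx [i _ xE]]]; rewrite -{x}xE in nx.
have [zi mi] := hX i.
(* Once [j] exceeds both [n] and the witness [h' i], [U_n] is active at stage [j], which forces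
   [h' j] into it. *)
apply: sub_finite_set (finite_image h' (finite_II (maxn n.+1 (h' i).+1))).
move=> _ [[j _ <-] nj]; exists j => //=; rewrite ltnNge geq_max.
apply/negP => /andP[lnj lij]; apply: nj; apply/uP.
have /and4P[_ _ _ /allP/(_ n)] := nextP (h j) j.
rewrite mem_iota /= lnj => /(_ isT)/implyP; apply.
apply/hasP; exists (h' i); first by rewrite mem_iota.
by rewrite zi /=; apply/andP; split; apply/uP.
Qed.

(** The neighbourhood of each chosen point is disjoint on [Z] from the set in which all later
    choices are made, so it isolates that point. *)
Lemma disjoint_case x0 : z x0 ->
  (forall m, csc_basis T m `&` [set x | z x] !=set0 ->
     ~ hyperconnected T (csc_basis T m `&` [set x | z x])) ->
  exists Y : set nat,
    [/\ Y `<=` csc_points T, infinite_set Y, Delta02 Y & discrete_subspace T Y].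
Proof.
move=> zx0 nhyper.
(* A state codes (y, a, m, w): the point y was chosen in U_a, and the rest of
   the construction takes place in U_m, whose nonemptiness is witnessed by w. *)
pose pt s := fstn s; pose nb s := fstn (sndn s).
pose rs s := fstn (sndn (sndn s)); pose wt s := sndn (sndn (sndn s)).
pose code y a m w := pairn y (pairn a (pairn m w)).
pose good s := u (rs s) (wt s) /\ z (wt s).
(* Inclusions and disjointness on [Z] are tested at the single point [b], so quantifying over [b]
   gives a $\Pi^0_1$ relation; the stored witness keeps nonemptiness decidable. *)
pose chi s s' b := [&& (pt s).+1 <= pt s', u (nb s') (pt s') && z (pt s'),
  u (rs s') (wt s') && z (wt s') &
  z b ==> [&& u (nb s') b ==> u (rs s) b, u (rs s') b ==> u (rs s) b &
             ~~ (u (nb s') b && u (rs s') b)]].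
have [m0 _ /uP mx0] := csc_basis_cover (zX _ zx0).
have [||||g [_ gchi glt gD]] := @Delta02_chain chi good (code 0 0 m0 x0).
- have := (recursive_fstn, recursive_sndn) => -[r1 r2].
  move=> n A B C rA rB rC; rewrite /chi /pt /nb /rs /wt.
  by repeat rec_env_tac.
- by rewrite /good /rs /wt /code !pairnK2 !pairnK1.
- move=> s [msw zw].
  have /existsNP[a /existsNP[b]] : ~ hyperconnected T (csc_basis T (rs s) `&` [set x | z x]).
    by apply: nhyper; exists (wt s); split=> //; exact/uP.
  move=> /not_implyP[[x [/uP ax [/uP mx zx]]] /not_implyP[[y [/uP by_ [/uP my zy]]] nab]].
  (* Both sets are cut down to the current one; the new point comes from the first, and the second,
     witnessed by [y], is kept for the continuation. *)
  have [a' [ax' asub]] := basis_meet _ _ _ ax mx.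
  have [b' [by' bsub]] := basis_meet _ _ _ by_ my.
  have [p [ap zp sp]] := zperf _ _ ax' zx (pt s).+1.
  exists (code p a' b' y) => c.
  rewrite /chi /nb /rs /wt {2 3 4}/pt /code !(pairnK1, pairnK2) sp ap zp by' zy /=.
  apply/implyP => zc; apply/and3P; split.
  + by apply/implyP => /asub[].
  + by apply/implyP => /bsub[].
  + apply/negP => /andP[/asub[/uP ac /uP mc] /bsub[/uP bc _]].
    by apply: nab; exists c.
- by move=> s s' _ /(_ 0)/and4P[? _ /andP[? ?] _].
have gin i : u (nb (g i.+1)) (pt (g i.+1)) /\ z (pt (g i.+1)).
  by have /and4P[_ /andP[]] := gchi i 0.
have gsub i b : z b -> [/\ u (nb (g i.+1)) b -> u (rs (g i)) b,
    u (rs (g i.+1)) b -> u (rs (g i)) b &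
    u (nb (g i.+1)) b -> ~~ u (rs (g i.+1)) b].
  move=> zb; have /and4P[_ _ _] := gchi i b; rewrite zb /=.
  move=> /and3P[/implyP ? /implyP ? ndis]; split=> // nbb.
  by move: ndis; rewrite nbb.
have gnest i j b : z b -> i <= j -> u (rs (g j)) b -> u (rs (g i)) b.
  move=> zb; elim: j => [|j IH]; first by rewrite leqn0 => /eqP->.
  rewrite leq_eqVlt => /orP[/eqP-> //|ij] mj; apply: IH => //.
  by have [_ + _] := gsub j b zb; apply.
have gdis i j b : i < j -> z b -> u (nb (g i.+1)) b -> ~ u (nb (g j.+1)) b.
  move=> ij zb ib jb; have [_ _ /(_ ib)/negP] := gsub i b zb; apply.
  by apply: (gnest i.+1 j) => //; have [+ _ _] := gsub j b zb; apply.
exists (range (fun i => fstn (g i.+1))); split=> //.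
- by move=> _ [i _ <-]; apply: zX; have [] := gin i.
- apply: unbounded_infinite => N; exists (fstn (g N.+1)); first by exists N.
  exact: (homo_ge (fun i => fstn (g i.+1))).
- move=> _ [i _ <-]; exists (nb (g i.+1)); have [ui zi] := gin i.
  apply/seteqP; split=> [t ->|t [/uP it [j _ jE]]].
    by split; [exact/uP|exists i].
  subst t; rewrite /=; have [uj zj] := gin j.
  by case: (ltngtP i j) => [lij|lji|->] //; [case: (gdis i j _ lij zj)|
    case: (gdis j i _ lji zj)].
Qed.

End Perfect.

(** * The case distinction *)

Theorem theorem6p12 (T : csc_space) (Tinf : infinite_csc T)
    (Tcomp : computable_csc T) (TT1 : T1_csc T) :
  (exists Y : set nat,
     [/\ Y `<=` csc_points T, infinite_set Y, Delta02 Y &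
         discrete_subspace T Y]) \/
  (exists Y : set nat,
     [/\ Y `<=` csc_points T, infinite_set Y, computable_set Y &
         cofinite_subspace T Y]).
Proof.
have [[chiX [rX XP]] [chiU [rU UP]] _] := Tcomp.
pose xs x := chiX [tuple x]; pose u n x := chiU [tuple n; x].
have ru : recursive2 u.
  apply: recursive2P; apply: recursive_ext rU => v; rewrite /u; congr (nat_of_bool (chiU _)).
  by apply: eq_from_tnth => -[[|[|i]] Hi] //; rewrite !(tnth_nth 0).
have uP n x : csc_basis T n x <-> u n x by exact: (UP [tuple n; x]).
have rxs : recursive1 xs.
  apply: recursive1P; apply: recursive_ext rX => v; rewrite /xs; congr (nat_of_bool (chiX _)).
  by apply: eq_from_tnth => -[[|i] Hi] //; rewrite !(tnth_nth 0).
have xsP x : csc_points T x <-> xs x by exact: (XP [tuple x]).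
have [isofin|] := pselect (finite_set [set x | exists n, csc_basis T n = [set x]]);
  last by move=> isoinf; left; exact: (isolated_case T u).
have [N Niso] : exists N, forall x n, csc_basis T n = [set x] -> x < N.
  apply: contrapT => nN; apply: unbounded_infinite isofin => N.
  apply: contrapT => nx; apply: nN; exists N => x n nE; rewrite ltnNge.
  by apply/negP => Nx; apply: nx; exists x => //; exists n.
(* The bound [N] comes from a classical argument, but as a constant it leaves [z] computable. *)
pose z x := xs x && (N <= x).
have rz : recursive1 z by move=> n A rA; rewrite /z; repeat rec_env_tac.
have zX x : z x -> csc_points T x by move=> /andP[/xsP].
have zperf n x : u n x -> z x -> forall M, exists y, [/\ u n y, z y & M <= y].
  move=> /uP nx /andP[_ Nx] M.
  (* A finite basic set would make [x] isolated, although [x] is at least [N]. *)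
  have [nfin|ninf] := pselect (finite_set (csc_basis T n)).
    have [k /Niso] := @finite_basis_isolated T TT1 n x nfin nx.
    by rewrite ltnNge Nx.
  have [y ny] := infinite_unbounded _ ninf (maxn M N); rewrite geq_max => /andP[My Ny].
  exists y; split=> //; first exact/uP.
  by rewrite /z Ny andbT; apply/xsP; exact: csc_basis_sub ny.
have [[m [mz hyper]]|nhyper] := pselect (exists m,
    csc_basis T m `&` [set x | z x] !=set0 /\ hyperconnected T (csc_basis T m `&` [set x | z x])).
  by right; exact: (@hyperconnected_case T TT1 u z ru uP rz zX zperf m).
left; have [x Xx Nx] := infinite_unbounded _ Tinf N.
apply: (@disjoint_case T u z ru uP rz zX zperf x) => [|m mz hyper].
  by rewrite /z Nx andbT; exact/xsP.
by apply: nhyper; exists m.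
Qed.
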